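(* Let $X=\{x_1,\ldots,x_n\}$ and let $R=\{x_jx_i=u_{ij}\mid 1\le i<j\le n\}$ be a set of quadratic relations satisfying conditions ( *1), ( *2), ( *3) given in the context. Define $r:X^2\to X^2$ as follows: $r(x_ix_i)=x_ix_i$ for all $i$, and if $(x_jx_i=x_{i'}x_{j'})\in R$ (with $j>i$, $i'<j'$) then $r(x_jx_i)=x_{i'}x_{j'}$ and $r(x_{i'}x_{j'})=x_jx_i$. Then: 1. $r^2=\mathrm{id}_{X^2}$. 2. $r$ satisfies the set-theoretic Yang-Baxter equation, i.e. $r_1r_2r_1=r_2r_1r_2$ as maps $X^3\to X^3$. 3. Given $a,b\in\{1,\ldots,n\}$ there exist unique $c,d\in\{1,\ldots,n\}$ such that $r(x_cx_a)=x_dx_b$. Furthermore, if $a=b$ then $c=d$.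
   Context: $X$ is a set of $n$ distinct generators. Elements of $X^m$ are written as words of length $m$ in $X$. For $r:X^2\to X^2$, the map $r_i:X^m\to X^m$ is $\mathrm{id}_{X^{i-1}}\times r\times\mathrm{id}_{X^{m-i-1}}$ (i.e. $r$ applied to letters $i,i+1$). Conditions on $R=\{x_jx_i=u_{ij}\mid 1\le i<j\le n\}$: ( *1) For every $i<j$, $u_{ij}=x_{i'}x_{j'}$ with $i'<j'$ and $i'<j$. ( *2) As $(i,j)$ varies over the pairs with $i<j$, every pair $(i',j')$ with $i'<j'$ occurs exactly once. ( *3) The overlaps $x_kx_jx_i$ for $k>j>i$ do not give rise to new relations in the semigroup with unit $S=\langle X;R\rangle$. That is, for the rewriting system $x_jx_i\to u_{ij}$ ($j>i$), the two ways of reducing $x_kx_jx_i$ (starting with $x_kx_j$ or starting with $x_jx_i$) lead to the same word of the form $x_ax_bx_c$, $a\le b\le c$. Equivalently, every element of $S$ is uniquely of the form $x_1^{a_1}\cdots x_n^{a_n}$ with $(a_1,\ldots,a_n)\in\mathbb{N}^n$. *)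

(* Defs.v *)
From mathcomp Require Import all_boot.
From Stdlib Require Export Relation_Operators.

Set Implicit Arguments.
Unset Strict Implicit.
Unset Printing Implicit Defensive.

(* The generators x_1, ..., x_n are the elements of 'I_n (numbered from 0).   *)
(* A family of relations x_j x_i = u_ij, for i < j, is given by               *)
(* u : 'I_n -> 'I_n -> 'I_n * 'I_n, where u i j = (i', j') encodes            *)
(* u_ij = x_i' x_j'. Values of u i j with j <= i are never used.              *)

Section Relations.
Variables (n : nat) (u : 'I_n -> 'I_n -> 'I_n * 'I_n).

Definition star1 : Prop :=
  forall i j : 'I_n, i < j -> (u i j).1 < (u i j).2 /\ (u i j).1 < j.

Definition star2 : Prop :=
  forall i' j' : 'I_n, i' < j' ->
    exists! p : 'I_n * 'I_n, p.1 < p.2 /\ u p.1 p.2 = (i', j').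

Definition word2 (p : 'I_n * 'I_n) : seq 'I_n := [:: p.1; p.2].

Inductive rewrite_step : seq 'I_n -> seq 'I_n -> Prop :=
| RewriteStep (s t : seq 'I_n) (i j : 'I_n) : i < j ->
    rewrite_step (s ++ [:: j; i] ++ t) (s ++ word2 (u i j) ++ t).

Definition reduces : seq 'I_n -> seq 'I_n -> Prop :=
  clos_refl_trans (seq 'I_n) rewrite_step.

(* The two starting words are the results of rewriting x_k x_j, respectively  *)
(* x_j x_i, inside x_k x_j x_i. Under star1 every later step is forced, so    *)
(* each of the two has exactly one reduction to a sorted word.                *)
Definition star3 : Prop :=
  forall i j k : 'I_n, i < j -> j < k ->
    exists a b c : 'I_n, a <= b /\ b <= c /\
      reduces (word2 (u j k) ++ [:: i]) [:: a; b; c] /\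
      reduces (k :: word2 (u i j)) [:: a; b; c].

(* In the last case a < b, and the pair (j, i) with i < j and u_ij = x_a x_b  *)
(* exists and is unique under star2; the default value None => ab is never    *)
(* reached (see rmapE).                                                       *)
Definition rmap (ab : 'I_n * 'I_n) : 'I_n * 'I_n :=
  let: (a, b) := ab in
  if a == b then ab
  else if b < a then u b a
  else if [pick p : 'I_n * 'I_n | (p.1 < p.2) && (u p.1 p.2 == ab)] is Some p
  then (p.2, p.1) else ab.

Lemma rmapE : star1 -> star2 ->
  (forall i : 'I_n, rmap (i, i) = (i, i)) /\
  (forall i j : 'I_n, i < j -> rmap (j, i) = u i j /\ rmap (u i j) = (j, i)).
Proof.
move=> u1 u2; split=> [i | i j ij]; first by rewrite /rmap eqxx.
split; first by rewrite /rmap -val_eqE /= gtn_eqF ?ij.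
have [+ _] := u1 i j ij; case E: (u i j) => [a b] /= ab.
rewrite /rmap -val_eqE /= ltn_eqF // ltnNge (ltnW ab) /=.
have [q [_ uq]] := u2 a b ab.
case: pickP => [p /andP[lep /eqP up] | /(_ (i, j))]; last by rewrite /= ij E eqxx.
by rewrite -(uq p) // (uq (i, j)).
Qed.

End Relations.

Section YangBaxter.
Variables (X : Type) (r : X * X -> X * X).

Definition r_1 (w : X * X * X) : X * X * X :=
  let: (x, y, z) := w in ((r (x, y)).1, (r (x, y)).2, z).

Definition r_2 (w : X * X * X) : X * X * X :=
  let: (x, y, z) := w in (x, (r (y, z)).1, (r (y, z)).2).

Definition yang_baxter : Prop := r_1 \o r_2 \o r_1 =1 r_2 \o r_1 \o r_2.

End YangBaxter.

(* Main.v *)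
Require Import Defs.
From mathcomp Require Import all_boot.
From mathcomp Require Import zify.
From Stdlib Require Import Operators_Properties.

(** Write r(x, y) = (lact x y, ract x y), and call two words equal in S if they
    have a common reduct. Up to notation, r is a solution as soon as ract is a
    right action of S by permutations: the map
    (x, y, z) |-> (ract (ract x y) z, ract y z, z) is then a bijection of X^3
    that turns r_1 and r_2 into the transpositions of adjacent coordinates,
    for which the braid relation is clear (lemmas coordinates_r_1,
    coordinates_r_2). That ract^~ y is a permutation is the third claim
    (ract_inj), and that it respects the relations is ract_action.

    Two general tools are used. First, star3 makes the rewriting system
    confluent, so distinct nondecreasing words are distinct in S. Second, the
    r_1, r_2-orbit of a word x_k x_j x_i with k > j > i meets the nondecreasing
    words in a strictly increasing one only (strict_normal_form). Hence words of
    the orbits of xxy and xyy, for x < y, never decrease twice in a row, and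
    this yields two inequalities between letters:
    ract x (lact x y) <= ract x y and, if ract x y < y,
    lact x y <= lact (ract x y) y.

    The permutation property is a counting argument. Let N be a multiple of all
    periods of self-maps of X. In x^k y, for x < y, move y to the left through
    the power of x: the letters that come out on the right form a nonincreasing
    sequence that starts with ract x y, so eventually they are a constant g, and
    a power g^N appears. If all letters t < c satisfy
    g^N t = t h^N for g < t, with some h < t depending on g and t, and if
    ract x y < c, this power can be carried to the right end, and after
    cancellation x^N y = y h^N with h < c (lemma pass). Different x give
    different nondecreasing words x^N y, hence different h. So for each y there
    are at most as many x < y with ract x y < c as there are letters smaller
    than y and c. As r matches the increasing pairs with the decreasing ones,
    summing over y gives the same total for both counts, so that all these
    inequalities are equalities. For y = c this says that ract x c < c
    for all x < c; the hypothesis on letters then extends to c, and one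
    concludes by induction (all_passable). The equalities also show that
    ract^~ y maps the letters below y onto themselves, and then r reversed gives
    the same for the letters above y.

    Once ract^~ y is a permutation, the weak inequalities become equalities
    along its cycles. One gets that lact x is a permutation too, and that
    x^N y = y (ract x y)^N in S for all x and y (power_exchange). Pushing
    x^N through both sides of y z = y' z' and comparing normal forms yields
    ract_action. *)

Set Implicit Arguments.
Unset Strict Implicit.
Unset Printing Implicit Defensive.

#[local] Arguments rmap : simpl never.

Section SkewRelations.
Variables (n : nat) (u : 'I_n -> 'I_n -> 'I_n * 'I_n).
Hypotheses (u1 : star1 u) (u2 : star2 u) (u3 : star3 u).

Local Notation X := 'I_n.
Local Notation r := (rmap u).
Implicit Types (x y z : X) (w v : seq X).

(** * The map r on pairs of letters *)

Definition lact (x y : X) : X := (r (x, y)).1.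
Definition ract (x y : X) : X := (r (x, y)).2.

Lemma rmap_pair x y : r (x, y) = (lact x y, ract x y).
Proof. exact: surjective_pairing. Qed.

Lemma rmap_diag x : r (x, x) = (x, x).
Proof. exact: (rmapE u1 u2).1. Qed.

Lemma rmap_desc x y : y < x -> r (x, y) = u y x.
Proof. by move=> yx; have [->] := (rmapE u1 u2).2 y x yx. Qed.

Lemma rmap_ascP x y : x < y ->
  exists i j : X, [/\ i < j, u i j = (x, y) & r (x, y) = (j, i)].
Proof.
move=> xy; have [[i j] [[/= ij uij] _]] := u2 xy.
have [_ ruij] := (rmapE u1 u2).2 i j ij.
by rewrite uij in ruij; exists i, j.
Qed.

Lemma rmapK : involutive r.
Proof.
case=> x y; case: (ltngtP x y) => [xy|yx|/val_inj->].
- have [i [j [ij <- ruij]]] := rmap_ascP xy.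
  by have [rji rij] := (rmapE u1 u2).2 i j ij; rewrite rij.
- by have [rji rij] := (rmapE u1 u2).2 y x yx; rewrite rji.
- by rewrite !rmap_diag.
Qed.

Lemma rmap_sym x y x' y' : r (x, y) = (x', y') -> r (x', y') = (x, y).
Proof. by move=> <-; apply: rmapK. Qed.

Lemma lact_ract_asc x y : x < y -> ract x y < lact x y /\ x < lact x y.
Proof.
move=> xy; have [i [j [ij uij rxy]]] := rmap_ascP xy.
by have [_] := u1 ij; rewrite /lact /ract rxy uij.
Qed.

Lemma lact_ract_desc x y : y < x -> lact x y < ract x y /\ lact x y < x.
Proof. by move=> yx; rewrite /lact /ract rmap_desc //; apply: u1. Qed.

(** * Normal forms *)

Lemma step_reduces w w' : rewrite_step u w w' -> reduces u w w'.
Proof. exact: rt_step. Qed.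

Lemma reduces_refl w : reduces u w w.
Proof. exact: rt_refl. Qed.

Lemma reduces_trans w v w' : reduces u w v -> reduces u v w' -> reduces u w w'.
Proof. exact: rt_trans. Qed.

Lemma reduces_inv w w' : reduces u w w' ->
  w' = w \/ exists2 v, rewrite_step u w v & reduces u v w'.
Proof.
move=> ww'; have [|v w'' wv vw] := clos_rt_rt1n _ _ _ _ ww'; first by left.
by right; exists v => //; apply: clos_rt1n_rt.
Qed.

Lemma step_cat p q w w' :
  rewrite_step u w w' -> rewrite_step u (p ++ w ++ q) (p ++ w' ++ q).
Proof.
case=> s t i j ij; have := RewriteStep u (p ++ s) (t ++ q) ij.
by rewrite -!catA.
Qed.

Lemma reduces_cat p q w w' :
  reduces u w w' -> reduces u (p ++ w ++ q) (p ++ w' ++ q).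
Proof.
elim=> [a b /(step_cat p q)/step_reduces //| a | a b c _ ab _ bc].
- exact: reduces_refl.
- exact: reduces_trans ab bc.
Qed.

Lemma step_swap s t x y :
  y < x -> rewrite_step u (s ++ [:: x; y] ++ t) (s ++ word2 (r (x, y)) ++ t).
Proof. by move=> yx; rewrite rmap_desc //; apply: RewriteStep. Qed.

(** The word read as a number in base n. Rewriting at one place lowers the more
    significant of two digits, so this measure proves termination. *)
Definition weight (w : seq X) : nat :=
  foldl (fun (a : nat) (x : X) => a * n + x) 0 w.

Lemma step_weight w w' : rewrite_step u w w' -> weight w' < weight w.
Proof.
case=> s t i j ij; rewrite /weight !foldl_cat.
move: (foldl _ 0 s) => a /=; have [_] := u1 ij.
case: (u i j) => x y /= xj.
have: (a * n + x) * n + y < (a * n + j) * n + i by have := ltn_ord y; nia.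
have n0 : 0 < n by exact: leq_ltn_trans (ltn_ord i).
elim: t (_ * n + y) (_ * n + i) => //= z t IH b c bc; apply: IH.
by rewrite ltn_add2r ltn_pmul2r.
Qed.

(** By confluence this is equality in the monoid S. *)
Definition joinable (a b : seq X) : Prop :=
  exists v, reduces u a v /\ reduces u b v.

Lemma joinable_cat p q a b :
  joinable a b -> joinable (p ++ a ++ q) (p ++ b ++ q).
Proof.
by case=> v [av bv]; exists (p ++ v ++ q); split; apply: reduces_cat.
Qed.

(** A redex at the left end and another one anywhere: the two coincide, overlap
    in one letter, where star3 applies, or are disjoint. *)
Lemma critical_pair s' t t' (i j i' j' : X) : i < j -> i' < j' ->
  [:: j; i] ++ t = s' ++ [:: j'; i'] ++ t' ->
  joinable (word2 (u i j) ++ t) (s' ++ word2 (u i' j') ++ t').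
Proof.
move=> ij ij'; case: s' => [|x [|y s']] /=.
- by case=> <- <- ->; exists (word2 (u i j) ++ t'); split; apply: reduces_refl.
- case=> <- ei ->; move: ij'; rewrite -{}ei => ij'.
  have [a [b [c [_ [_ [lv rv]]]]]] := u3 ij' ij.
  have := @joinable_cat [::] t' _ _ (ex_intro _ _ (conj lv rv)).
  by rewrite -!catA.
- case=> <- <- ->; exists (word2 (u i j) ++ s' ++ word2 (u i' j') ++ t'); split.
  + have := step_cat (word2 (u i j) ++ s') t' (RewriteStep u [::] [::] ij').
    by rewrite -!catA => /step_reduces.
  + exact/step_reduces/(RewriteStep u [::] _ ij).
Qed.

Lemma local_confluence w a b :
  rewrite_step u w a -> rewrite_step u w b -> joinable a b.
Proof.
move=> wa wb; case: wa wb => s t i j ij.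
move Ew: (_ ++ _) => w' wb; case: wb Ew => s' t' i' j' ij'.
elim: s s' => [|x s IH] s'; first exact: critical_pair.
case: s' => [/esym/(critical_pair ij' ij) [v [av bv]]|x' s' /= [-> /IH]].
  by exists v.
by move/(joinable_cat [:: x'] [::]); rewrite !cats0.
Qed.

(** Newman's lemma: local confluence and termination give confluence. *)
Lemma confluence w a b : reduces u w a -> reduces u w b -> joinable a b.
Proof.
have [m] := ubnP (weight w); elim: m w a b => // m IH w a b wm.
move=> wa wb; case: (reduces_inv wa) => [->|[c wc ca]].
  by exists b; split=> //; apply: reduces_refl.
case: (reduces_inv wb) => [->|[d wd db]].
  by exists a; split=> //; apply: reduces_refl.
have [e [ce de]] := local_confluence wc wd.
have [f [af ef]] := IH _ _ _ (leq_trans (step_weight wc) wm) ca ce.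
have [g [fg bg]] :=
  IH _ _ _ (leq_trans (step_weight wd) wm) (reduces_trans de ef) db.
by exists g; split=> //; apply: reduces_trans fg.
Qed.

Lemma joinable_refl a : joinable a a.
Proof. by exists a; split; apply: reduces_refl. Qed.

Lemma joinable_sym a b : joinable a b -> joinable b a.
Proof. by case=> v [av bv]; exists v. Qed.

Lemma joinable_trans b a c : joinable a b -> joinable b c -> joinable a c.
Proof.
case=> v [av bv] [v' [bv' cv']]; have [w [vw v'w]] := confluence bv bv'.
by exists w; split; [exact: reduces_trans vw | exact: reduces_trans v'w].
Qed.

Lemma joinable_swap x y : joinable [:: x; y] [:: lact x y; ract x y].
Proof.
rewrite -[[:: lact x y; _]]/(word2 (lact x y, ract x y)) -rmap_pair.
case: (ltngtP x y) => [xy|yx|/val_inj->]; last 1 first.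
- by rewrite rmap_diag; apply: joinable_refl.
- have [lt _] := lact_ract_asc xy.
  have /step_reduces := step_swap [::] [::] lt.
  rewrite (@rmap_sym x y) ?rmap_pair //= => red.
  by exists [:: x; y]; split; first exact: reduces_refl.
- have /step_reduces := step_swap [::] [::] yx; rewrite cats0 => red.
  by exists (word2 (r (x, y))); split=> //; exact: reduces_refl.
Qed.

Definition increasing (w : seq X) : bool := sorted (fun x y : X => x <= y) w.

Lemma increasing_stuck w v : increasing w -> rewrite_step u w v -> False.
Proof.
move=> sw st; case: st sw => s t i j ij.
rewrite /increasing; case: s => [|x s] /=; first by rewrite leqNgt ij.
by rewrite cat_path /= [j <= i]leqNgt ij !andbF.
Qed.

Lemma increasing_reduces w v : increasing w -> reduces u w v -> v = w.
Proof.
by move=> sw wv; case: (reduces_inv wv) => // -[v' /(increasing_stuck sw)].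
Qed.

Lemma increasing_joinable w v : increasing w -> joinable v w -> reduces u v w.
Proof. by move=> sw [w' [vw ww']]; rewrite -(increasing_reduces sw ww'). Qed.

Lemma normal_form_unique w v :
  increasing w -> increasing v -> joinable w v -> w = v.
Proof.
move=> sw sv wv.
by rewrite (increasing_reduces sw (increasing_joinable sv wv)).
Qed.

Lemma increasingPn w : ~~ increasing w ->
  exists s t (x y : X), y < x /\ w = s ++ [:: x; y] ++ t.
Proof.
elim: w => [//|x [//|y w] IH]; rewrite /increasing /= negb_and -ltnNge.
have [yx _|xy /= /IH [s [t [x' [y' [yx' ->]]]]]] := ltnP y x.
  by exists [::], w, x, y.
by exists (x :: s), t, x', y'.
Qed.

Lemma normal_form_exists w : exists2 v, increasing v & reduces u w v.
Proof.
have [m] := ubnP (weight w); elim: m w => // m IH w wm.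
have [sw|/increasingPn [s [t [x [y [yx ew]]]]]] := boolP (increasing w).
  by exists w => //; apply: reduces_refl.
have st := step_swap s t yx; rewrite -ew in st.
have [v sv red] := IH _ (leq_trans (step_weight st) wm).
by exists v => //; apply: reduces_trans red; exact: step_reduces.
Qed.

(** Each rewriting step leaves the first letter alone or, by the second half of
    star1, lowers it. *)
Lemma head_reduces z w w' : reduces u w w' -> head z w' <= head z w.
Proof.
elim=> [a b | a | a b c _ ab _ bc] //; last exact: leq_trans bc ab.
by case=> [[|x s]] t i j ij //=; have [_ /ltnW] := u1 ij.
Qed.

(** Left cancellation is only available inside the class of a word x v that is
    already in normal form: then x is the smallest first letter in the class, so
    the normal form of w cannot begin with a smaller letter. *)
Lemma joinable_cancel x w v : increasing (x :: v) ->
  joinable (x :: w) (x :: v) -> joinable w v.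
Proof.
move=> sxv xwv; have [p sp wp] := normal_form_exists w.
have xp : joinable (x :: p) (x :: v).
  apply: joinable_trans xwv; apply: joinable_sym; exists (x :: p).
  split; last exact: reduces_refl.
  by have := reduces_cat [:: x] [::] wp; rewrite !cats0.
case: p sp wp xp => [|y p] sp wp xp.
  have [<-] := normal_form_unique (isT : increasing [:: x]) sxv xp.
  by exists [::]; split=> //; apply: reduces_refl.
have [xy|yx] := leqP x y.
  have sxyp : increasing (x :: y :: p) by rewrite /increasing /= xy.
  have [<-] := normal_form_unique sxyp sxv xp.
  by exists (y :: p); split=> //; apply: reduces_refl.
have xyp : joinable (word2 (r (x, y)) ++ p) (x :: v).
  apply: joinable_trans xp; apply: joinable_sym; exists (word2 (r (x, y)) ++ p).
  split; last exact: reduces_refl.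
  exact/step_reduces/(step_swap [::] p yx).
have := head_reduces x (increasing_joinable sxv xyp).
by rewrite rmap_pair /= leqNgt; have [_ ->] := lact_ract_desc yx.
Qed.

Lemma joinable_cancel_nseq k x w v : increasing (nseq k x ++ v) ->
  joinable (nseq k x ++ w) (nseq k x ++ v) -> joinable w v.
Proof.
elim: k => //= k IH sv /(joinable_cancel sv); apply: IH.
exact: path_sorted sv.
Qed.

(** * Words of length three *)

Definition word3 (t : X * X * X) : seq X := [:: t.1.1; t.1.2; t.2].

(** The Boolean stands for a position: false for the first two letters, true for
    the last two. *)
Definition apply_at (q : bool) : X * X * X -> X * X * X :=
  if q then r_2 r else r_1 r.

Definition ascent (q : bool) (t : X * X * X) : bool :=
  if q then t.1.2 < t.2 else t.1.1 < t.1.2.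

Definition descent (q : bool) (t : X * X * X) : bool :=
  if q then t.2 < t.1.2 else t.1.2 < t.1.1.

Lemma apply_atK q : involutive (apply_at q).
Proof.
case: q => -[[x y] z] /=.
  by rewrite -(surjective_pairing (r (y, z))) rmapK.
by rewrite -(surjective_pairing (r (x, y))) rmapK.
Qed.

Lemma descent_ascent q t : descent q t -> ascent q (apply_at q t).
Proof. by case: q t => -[[x y] z] /= /lact_ract_desc[]. Qed.

Lemma ascent_not_peak q t :
  ascent q t -> ~~ (descent false t && descent true t).
Proof.
by case: q => /= /ltnW; rewrite leqNgt => /negbTE->; rewrite ?andbF.
Qed.

Lemma joinable_apply_at q t : joinable (word3 t) (word3 (apply_at q t)).
Proof.
case: q t => -[[x y] z].
  by have := joinable_cat [:: x] [::] (joinable_swap y z).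
by have := joinable_cat [::] [:: z] (joinable_swap x y).
Qed.

Lemma step_word3 t v : rewrite_step u (word3 t) v ->
  exists2 q, descent q t & v = word3 (apply_at q t).
Proof.
case: t => -[x y] z; move Ew: (word3 _) => w st; case: st Ew => s t i j ij.
case: s => [|x' [|y' [|z' [|? s]]]] //= [].
- by move=> -> -> <-; exists false; rewrite //= /r_1 rmap_desc.
- by move=> <- -> -> <-; exists true; rewrite //= /r_2 rmap_desc.
Qed.

(** The walk in the orbit of t under r_1 and r_2 that starts in position p and
    alternates the two maps. The second component is the next position. *)
Definition zigzag (t : X * X * X) (p : bool) (k : nat) : (X * X * X) * bool :=
  iter k (fun tq => (apply_at tq.2 tq.1, ~~ tq.2)) (t, p).

Lemma zigzagS s p k q t :
  zigzag s p k = (apply_at q t, q) -> zigzag s p k.+1 = (t, ~~ q).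
Proof. by rewrite /zigzag iterS => -> /=; rewrite apply_atK. Qed.

(** Below a word with an ascent at q, the only possible rewriting step is at the
    other position, and it creates an ascent there. So the reduction to s is
    forced, and backwards it is the alternating walk that starts at s. The walk
    can only start in position p, because it starts where s has an ascent. On
    the way each word has an ascent, so none of them decreases twice. *)
Lemma descending_run s p t q : (forall q', ascent q' s -> q' = p) ->
  reduces u (word3 t) (word3 s) -> ascent q t ->
  exists k, zigzag s p k = (t, q) /\
    forall j, j <= k -> ~~ [&& descent false (zigzag s p j).1
                             & descent true (zigzag s p j).1].
Proof.
move=> sp ts; move Ew: (word3 t) ts => w; move Ev: (word3 s) => v ts.
have {}ts := clos_rt_rt1n _ _ _ _ ts.
elim: ts t q Ew Ev => [a|a b c ab _ IH] t q et es qt.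
  have ets : t = s.
    by move: et; rewrite -es; case: (t) (s) => [[? ?] ?] [[? ?] ?] [-> -> ->].
  exists 0; split; first by rewrite /zigzag /= ets (sp q) // -ets.
  move=> j; rewrite leqn0 => /eqP->; rewrite -ets; exact: ascent_not_peak qt.
rewrite -et in ab; have [q' dq' eb] := step_word3 ab.
have [k [zk nk]] := IH _ q' (esym eb) es (descent_ascent dq').
have eq : q = ~~ q'.
  by move: qt dq'; case: q (q') => -[] //= /ltn_trans lt /lt; rewrite ltnn.
have zk1 : zigzag s p k.+1 = (t, q) by rewrite eq; apply: zigzagS.
exists k.+1; split=> //.
move=> j; rewrite leq_eqVlt => /predU1P[->|]; last exact: nk.
rewrite zk1; exact: ascent_not_peak qt.
Qed.

(** Start with xyz, where x > y > z, and reduce after a first step in either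
    position: both runs end in the same s. If s had at most one ascent,
    both would be the same alternating walk out of s. Then xyz is the first
    twice decreasing word on that walk, reached once by r_1 and once by r_2,
    which is absurd as the walk determines the position of each step. *)
Lemma strict_normal_form (x y z : X) (s : X * X * X) : z < y -> y < x ->
  increasing (word3 s) -> joinable [:: x; y; z] (word3 s) ->
  ascent false s && ascent true s.
Proof.
move=> zy yx ss xyzs; apply/negPn/negP => nas.
have [p sp] : exists p, forall q, ascent q s -> q = p.
  by case: (boolP (ascent true s)) nas => a; rewrite ?andbT => na;
    [exists true | exists false] => -[] // b; rewrite b in na a.
have run q : exists k, zigzag s p k = (apply_at q (x, y, z), q) /\
    forall j, j <= k -> ~~ [&& descent false (zigzag s p j).1
                             & descent true (zigzag s p j).1].
  apply: descending_run sp _ _.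
    apply: (increasing_joinable ss); apply: joinable_trans xyzs.
    exact/joinable_sym/(joinable_apply_at q (x, y, z)).
  by apply: descent_ascent; case: q.
have [k [zk nk]] := run false; have [l [zl nl]] := run true.
have zk1 := zigzagS zk; have zl1 := zigzagS zl.
case: (ltngtP k l) => [/nl|/nk|kl].
- by rewrite zk1 /= zy yx.
- by rewrite zl1 /= zy yx.
- by move: zl1; rewrite -kl zk1.
Qed.

(** Contrapositive form, ready for the orbits of xxy and xyy. *)
Lemma degenerate_form_ascent (x y z : X) (s : X * X * X) :
  increasing (word3 s) -> ~~ (ascent false s && ascent true s) ->
  y < x -> joinable [:: x; y; z] (word3 s) -> y <= z.
Proof.
move=> ss nas yx xyzs; rewrite leqNgt; apply: contra nas => zy.
exact: strict_normal_form zy yx ss xyzs.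
Qed.

(** Look at the word obtained from xxy by r_2 and then r_1. *)
Lemma ract_lact_asc_le x y : x < y -> ract x (lact x y) <= ract x y.
Proof.
move=> xy; have [_ xh] := lact_ract_asc xy.
apply: (@degenerate_form_ascent (lact x (lact x y)) _ _ (x, x, y)).
- by rewrite /increasing /= leqnn (ltnW xy).
- by rewrite /= ltnn.
- by have [] := lact_ract_asc xh.
- apply: joinable_sym.
  apply: joinable_trans (joinable_apply_at true (x, x, y)) _.
  exact: (joinable_apply_at false).
Qed.

(** Look at the word obtained from xyy by r_1 and then r_2. *)
Lemma lact_asc_le x y : x < y -> ract x y < y -> lact x y <= lact (ract x y) y.
Proof.
move=> xy ty; rewrite leqNgt; apply/negP => lt.
have [gt _] := lact_ract_asc ty.
have: lact (ract x y) y <= ract (ract x y) y; last by rewrite leqNgt gt.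
apply: (@degenerate_form_ascent (lact x y) _ _ (x, y, y)) => //.
- by rewrite /increasing /= leqnn (ltnW xy).
- by rewrite /= ltnn andbF.
- apply: joinable_sym.
  apply: joinable_trans (joinable_apply_at false (x, y, y)) _.
  exact: (joinable_apply_at true).
Qed.

(** * Passing powers *)

Lemma iter_period (T : finType) (f : T -> T) (y : T) k :
  #|T| <= k -> iter (k + #|T|`!) f y = iter k f y.
Proof.
move=> Tk; set m := #|T|.
have /trajectP [i im ei] := looping_order f y.
have om : order f y <= m by apply: max_card.
pose d := order f y - i.
have per j : i <= j -> iter (d + j) f y = iter j f y.
  move=> ij; have -> : d + j = (j - i) + order f y by rewrite /d; lia.
  by rewrite iterD ei -iterD subnK.
have ik : i <= k by lia.
have per' q : iter (q * d + k) f y = iter k f y.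
  by elim: q => // q IH; rewrite mulSn -addnA per // (leq_trans ik) // leq_addl.
have /dvdnP [q ->] : d %| m`! by apply: dvdn_fact; rewrite /d; lia.
by rewrite addnC per'.
Qed.

(** A multiple of the periods of all self-maps of X. The factor 2 makes it at
    least 2, so that a power of a letter has two equal adjacent letters. *)
Definition exponent : nat := (n`!).*2.
Local Notation N := exponent.

Lemma exponent_gt1 : 1 < N.
Proof. by rewrite /exponent; have := fact_gt0 n; lia. Qed.

Lemma iter_exponent (f : X -> X) y k : n <= k -> iter (k + N) f y = iter k f y.
Proof.
rewrite /exponent -addnn addnA => nk.
have nk' : #|X| <= k by rewrite card_ord.
have := iter_period f y nk'.
have := iter_period f y (leq_trans nk' (leq_addr n`! k)).
by rewrite card_ord => -> ->.
Qed.

Lemma iter_exponent_id (f : X -> X) : injective f -> iter N f =1 id.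
Proof.
move=> fI y.
have iterI k : injective (iter k f) by elim: k => // k IH a b /fI/IH.
by apply: (iterI n); rewrite -iterD iter_exponent.
Qed.

(** The letters emitted on the right when y moves to the left through x^k, the
    last emitted one first. *)
Fixpoint tails (x y : X) (k : nat) : seq X :=
  if k is k'.+1 then ract x (iter k' (lact x) y) :: tails x y k' else [::].

Lemma joinable_power x y k :
  joinable (nseq k x ++ [:: y]) (iter k (lact x) y :: tails x y k).
Proof.
elim: k => [|k IH]; first exact: joinable_refl.
have := joinable_cat [:: x] [::] IH.
rewrite !cats0 /= => /joinable_trans; apply.
exact: (joinable_cat [::] _ (joinable_swap x _)).
Qed.

Lemma iter_lact_gt x y k : x < y -> x < iter k (lact x) y.
Proof. by move=> xy; elim: k => //= k /lact_ract_asc[]. Qed.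

Lemma increasing_tails x y k : x < y ->
  increasing (ract x (iter k (lact x) y) :: tails x y k).
Proof.
move=> xy; elim: k => // k; rewrite /increasing /= => ->.
by rewrite andbT ract_lact_asc_le // iter_lact_gt.
Qed.

Lemma ract_iter_antimono x y j k : x < y -> j <= k ->
  ract x (iter k (lact x) y) <= ract x (iter j (lact x) y).
Proof.
move=> xy /subnK<-; elim: (k - j) => // i; rewrite addSn; apply: leq_trans.
by rewrite /= ract_lact_asc_le // iter_lact_gt.
Qed.

(** From index n on the iterates of lact x are periodic with period dividing N,
    hence so are the emitted letters; as these never increase, they are
    constant. *)
Lemma ract_iter_stable x y j : x < y -> j <= N ->
  ract x (iter (n + j) (lact x) y) = ract x (iter n (lact x) y).
Proof.
move=> xy jN; apply/val_inj/anti_leq; rewrite ract_iter_antimono ?leq_addr //=.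
have := @ract_iter_antimono x y (n + j) (n + N) xy.
by rewrite iter_exponent // leq_add2l => /(_ jN).
Qed.

Lemma tails_stable x y : x < y ->
  tails x y (n + N) = nseq N (ract x (iter n (lact x) y)) ++ tails x y n.
Proof.
move=> xy; suff H j : j <= N -> tails x y (n + j) =
    nseq j (ract x (iter n (lact x) y)) ++ tails x y n by exact: H.
elim: j => [|j IH] jN; first by rewrite addn0.
by rewrite addnS /= IH ?(ltnW jN) // ract_iter_stable // ltnW.
Qed.

Lemma last_tails x y k :
  last (ract x (iter k (lact x) y)) (tails x y k) = ract x y.
Proof. by elim: k. Qed.

Lemma tails_le x y k t : x < y -> t \in tails x y k -> t <= ract x y.
Proof.
move=> xy; elim: k => //= k IH.
by rewrite inE => /predU1P[->|//]; apply: (@ract_iter_antimono x y 0).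
Qed.

Lemma increasing_nseq_cat k x y : x < y -> increasing (nseq k x ++ [:: y]).
Proof.
move=> xy; elim: k => // -[_|k IH]; first by rewrite /increasing /= ltnW.
by rewrite /increasing /= leqnn.
Qed.

Definition passable (t : X) : Prop := forall x, x < t ->
  exists2 h : X, h < t & joinable (nseq N x ++ [:: t]) (t :: nseq N h).

(** The power that leaves a letter t is a power of a letter that is at most t,
    hence at most the next letter of T, so that it can be passed on. *)
Lemma pass_increasing g (T : seq X) : increasing (g :: T) ->
  (forall t, t \in T -> passable t) ->
  exists2 h : X, h <= last g T & joinable (nseq N g ++ T) (T ++ nseq N h).
Proof.
elim: T g => [|t T IH] g.
  by exists g => //; rewrite cats0; apply: joinable_refl.
rewrite /increasing /= => /andP[gt tT] pT.
have [h ht gth] : exists2 h : X, h <= t &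
    joinable (nseq N g ++ [:: t]) (t :: nseq N h).
  move: gt; rewrite leq_eqVlt => /predU1P[/val_inj->|gt].
    exists t => //.
    suff -> : t :: nseq N t = nseq N t ++ [:: t] by apply: joinable_refl.
    by elim: N => //= k {1}->.
  by have [h /ltnW] := pT t (mem_head t T) g gt; exists h.
have hT : increasing (h :: T).
  case: (T) tT => //= t' T' /andP[tt' ->].
  by rewrite /increasing /= (leq_trans ht tt').
have pT' t' : t' \in T -> passable t'.
  by move=> t'T; apply: pT; rewrite inE t'T orbT.
have [h' h'l hh'] := IH h hT pT'.
exists h'.
  apply: leq_trans h'l _; case: (T) => //=.
have := joinable_cat [::] T gth; rewrite -catA /= => /joinable_trans; apply.
by have := joinable_cat [:: t] [::] hh'; rewrite !cats0.
Qed.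

(** The letters emitted by x^(n+N) y are g^N followed by the n letters emitted
    by x^n y. Carrying g^N to the right end gives x^n y h^N, where h is at most
    the last letter ract x y, and x^n can be cancelled since x^(n+N) y is in
    normal form. *)
Lemma pass c x y :
  (forall t : X, t < c -> passable t) -> x < y -> ract x y < c ->
  exists2 h : X, h < c & joinable (nseq N x ++ [:: y]) (y :: nseq N h).
Proof.
move=> pc xy tc.
have [t tT|h hl gh] := pass_increasing (increasing_tails n xy).
  exact/pc/leq_ltn_trans/tc/tails_le/tT.
exists h; first by move: hl; rewrite last_tails // => /leq_ltn_trans; apply.
apply: joinable_sym; apply: (@joinable_cancel_nseq n x).
  by rewrite catA -nseqD increasing_nseq_cat.
rewrite catA -nseqD; apply: joinable_sym.
apply: joinable_trans (joinable_power _ _ _) _.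
rewrite tails_stable // iter_exponent //.
have := joinable_cat [:: iter n (lact x) y] [::] gh; rewrite !cats0.
move=> /joinable_trans; apply; apply: joinable_sym.
by have := joinable_cat [::] (nseq N h) (joinable_power x y n); rewrite -catA.
Qed.

(** * Counting *)

Definition ract_lt_count (c : nat) y : nat :=
  #|[pred x : X | (x < y) && (ract x y < c)]|.

Definition lt_count (c : nat) y : nat :=
  #|[pred b : X | (b < y) && (b < c)]|.

(** For c < y the map x |-> h of the lemma pass is injective, because the words
    x^N y are distinct normal forms. *)
Lemma ract_lt_count_le c y : (forall t : X, t < c -> passable t) ->
  ract_lt_count c y <= lt_count c y.
Proof.
move=> pc; have [yc|cy] := leqP y c.
  apply/subset_leq_card/subsetP => x; rewrite !inE => /andP[xy _].
  by rewrite xy (leq_trans xy yc).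
have /fin_all_exists [f fP] (x : X) : exists h : X, x < y -> ract x y < c ->
    h < c /\ joinable (nseq N x ++ [:: y]) (y :: nseq N h).
  case: (boolP ((x < y) && (ract x y < c))) => [/andP[xy tc]|].
    by have [h hc hP] := pass pc xy tc; exists h.
  by move=> nn; exists x => xy tc; rewrite xy tc in nn.
have fI : {in [pred x : X | (x < y) && (ract x y < c)] &, injective f}.
  move=> x x'; rewrite !inE => /andP[xy tx] /andP[xy' tx'] ff.
  have [_ jx] := fP _ xy tx; have [_ jx'] := fP _ xy' tx'.
  have: nseq N x ++ [:: y] = nseq N x' ++ [:: y].
    apply: normal_form_unique; try exact: increasing_nseq_cat.
    by apply: joinable_trans jx _; rewrite ff; apply: joinable_sym.
  by have := exponent_gt1; case: N => //= k _ [].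
rewrite /ract_lt_count -(card_in_image fI); apply/subset_leq_card/subsetP => h.
case/imageP => x; rewrite inE => /andP[xy tx] ->; rewrite inE.
by have [fc _] := fP _ xy tx; rewrite fc andbT (ltn_trans fc cy).
Qed.

(** The pair (x, y) = r(a, b) of a decreasing pair (a, b) is increasing, with
    ract x y = b. *)
Lemma sum_lt_count_le c : \sum_y lt_count c y <= \sum_y ract_lt_count c y.
Proof.
have pairs (P : X -> X -> bool) :
    \sum_y #|[pred x | P x y]| = #|[pred p : X * X | P p.2 p.1]|.
  under eq_bigr do rewrite -sum1_card; rewrite pair_big_dep -sum1_card /=.
  exact: eq_bigl.
rewrite !(pairs (fun x y => _ && _)).
pose f (p : X * X) := let: (x, y) := r p in (y, x).
have fI : injective f.
  move=> p p'; rewrite /f.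
  case E: (r p) => [x y]; case E': (r p') => [x' y'] [ey ex].
  by apply: (inv_inj rmapK); rewrite E E' ex ey.
rewrite -(card_image fI); apply/subset_leq_card/subsetP => q.
case/imageP => -[a b]; rewrite inE /= => /andP[ba bc] ->.
rewrite /f rmap_pair inE /=; have [-> _] := lact_ract_desc ba.
by rewrite /ract -rmap_pair rmapK.
Qed.

Lemma ract_lt_count_eq c y : (forall t : X, t < c -> passable t) ->
  ract_lt_count c y = lt_count c y.
Proof.
move=> pc.
have := leqif_sum (fun z (_ : xpredT z) => leqif_eq (ract_lt_count_le z pc)).
case=> _; rewrite eqn_leq sum_lt_count_le leq_sum.
  by move=> /= /esym/forallP/(_ y)/eqP.
by move=> z _; apply: ract_lt_count_le.
Qed.

(** For y = c the equality of counts leaves no exception among the x < c. *)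
Lemma ract_asc_lt_below (c x : X) : (forall t : X, t < c -> passable t) ->
  x < c -> ract x c < c.
Proof.
move=> pc xc.
have := ract_lt_count_eq c pc; rewrite /ract_lt_count /lt_count => e.
have sub : [pred z : X | (z < c) && (ract z c < c)]
    \subset [pred z : X | (z < c) && (z < c)].
  by apply/subsetP => z; rewrite !inE andbb => /andP[].
by have /(_ sub x) := subset_cardP e; rewrite !inE xc.
Qed.

Lemma all_passable c : passable c.
Proof.
have [m] := ubnP (val c); elim: m c => // m IH c cm.
have pc (t : X) : t < c -> passable t by move=> tc; apply/IH/(leq_trans tc).
by move=> x xc; apply: pass => //; apply: ract_asc_lt_below.
Qed.

Lemma ract_asc_lt x y : x < y -> ract x y < y.
Proof. by apply: ract_asc_lt_below => t _; apply: all_passable. Qed.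

Lemma ract_asc_onto (b : X) y : b < y -> exists2 x : X, x < y & ract x y = b.
Proof.
move=> yb.
have [/existsP[x /andP[xy /eqP ex]]|/existsPn nx] :=
  boolP [exists x : X, (x < y) && (ract x y == b)].
  by exists x.
have e c := ract_lt_count_eq (c := c) y (fun t _ => @all_passable t).
have : lt_count b y = lt_count b.+1 y.
  rewrite -!e; apply: eq_card => x; rewrite !inE ltnS [ract x y <= b]leq_eqVlt.
  case: (x < y) (nx x) => //= /negPf nb.
  by rewrite -[_ == nat_of_ord b]/(ract x y == b) nb.
suff /proper_card : [pred z : X | (z < y) && (z < b)]
    \proper [pred z : X | (z < y) && (z < b.+1)].
  by rewrite /lt_count => + e'; rewrite e' ltnn.
apply/properP; split.
  by apply/subsetP => z; rewrite !inE => /andP[-> /ltnW].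
by exists b; rewrite !inE yb ?ltnSn ?ltnn.
Qed.

(** * Nondegeneracy *)

Lemma ract_desc_gt x y : y < x -> y < ract x y.
Proof.
move=> yx; have [lt _] := lact_ract_desc yx.
have := ract_asc_lt lt; rewrite {1}/ract (@rmap_sym x y) //; exact: rmap_pair.
Qed.

Lemma ract_diag y : ract y y = y.
Proof. by rewrite /ract rmap_diag. Qed.

Lemma lact_diag y : lact y y = y.
Proof. by rewrite /lact rmap_diag. Qed.

(** Letters above y are reached by reading r backwards: if x < b and
    ract x b = y, then r maps (lact x b, y) back to (x, b). *)
Lemma ract_onto y (b : X) : exists x, ract x y = b.
Proof.
case: (ltngtP b y) => [/ract_asc_onto[x _ <-]|yb|/val_inj->]; first by exists x.
- have [x xb exy] := ract_asc_onto yb; exists (lact x b).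
  by rewrite -exy /ract -rmap_pair rmapK.
- by exists y; apply: ract_diag.
Qed.

Lemma ract_inj y : injective (ract^~ y).
Proof.
have [g gK] := fin_all_exists (ract_onto y).
have [h gh hg] := injF_bij (can_inj (g := ract^~ y) gK).
by move=> x x' /=; rewrite -(hg x) -(hg x') !gK => ->.
Qed.

(** By lact_asc_le the letter lact x y does not decrease along the orbit of x
    under the permutation ract^~ y, and the orbit is a cycle. *)
Lemma lact_asc_const x y : x < y -> lact (ract x y) y = lact x y.
Proof.
move=> xy; pose f := ract^~ y.
have fy k (z : X) : z < y -> iter k f z < y.
  by move=> zy; elim: k => // k; apply: ract_asc_lt.
have mono k (z : X) : z < y -> lact z y <= lact (iter k f z) y.
  move=> zy; elim: k => //= k /leq_trans; apply.
  by have lt := fy k z zy; apply/lact_asc_le/ract_asc_lt.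
apply/val_inj/anti_leq; rewrite (mono 1) // andbT.
have := mono N.-1 (f x) (fy 1 x xy).
rewrite -iterSr prednK; last exact: ltnW exponent_gt1.
by rewrite iter_exponent_id //; apply: ract_inj.
Qed.

(** Obtained from lact_asc_const by reading r backwards: r maps the pair
    (lact x y, ract x y) to (x, y), and if c is the letter below ract x y with
    ract c (ract x y) = lact x y, then r maps (c, ract x y) to (x, lact x y). *)
Lemma ract_lact_desc x y : y < x -> ract x (lact x y) = ract x y.
Proof.
move=> yx; have [lt _] := lact_ract_desc yx.
have [c clt ec] := ract_asc_onto lt.
have e : lact c (ract x y) = x.
  by rewrite -(lact_asc_const clt) ec {1}/lact -rmap_pair rmapK.
have /rmap_sym := rmap_pair c (ract x y); rewrite e ec => rx.
by rewrite {1}/ract rx.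
Qed.

Lemma lact_ract_inj x y y' :
  lact x y = lact x y' -> ract x y = ract x y' -> y = y'.
Proof.
move=> eh et; have : r (x, y) = r (x, y') by rewrite !rmap_pair eh et.
by move/(inv_inj rmapK) => [].
Qed.

Lemma lact_desc_inj x y y' : y < x -> y' < x -> lact x y = lact x y' -> y = y'.
Proof.
move=> yx yx' e; apply: (lact_ract_inj e).
by rewrite -(ract_lact_desc yx) e ract_lact_desc.
Qed.

(** The map lact x preserves the letters below x and those above x. Below x,
    ract_lact_desc recovers ract x y from lact x y. Above x, reading r backwards
    reduces injectivity to the case below, for the letter lact x y. *)
Lemma lact_inj x : injective (lact x).
Proof.
move=> y y' e.
case: (ltngtP y x) (ltngtP y' x) => [yx|xy|/val_inj yx] [yx'|xy'|/val_inj yx'].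
- exact: lact_desc_inj e.
- have [_ lt] := lact_ract_desc yx; have [_ gt] := lact_ract_asc xy'.
  by move: (ltn_trans lt gt); rewrite e ltnn.
- by have [_] := lact_ract_desc yx; rewrite e yx' lact_diag ltnn.
- have [_ lt] := lact_ract_desc yx'; have [_ gt] := lact_ract_asc xy.
  by move: (ltn_trans lt gt); rewrite e ltnn.
- apply: (lact_ract_inj e).
  have [lt _] := lact_ract_asc xy; have [lt' _] := lact_ract_asc xy'.
  rewrite -e in lt'; apply: lact_desc_inj lt lt' _.
  by rewrite {1}/lact -rmap_pair rmapK e /lact -rmap_pair rmapK.
- by have [_] := lact_ract_asc xy; rewrite e yx' lact_diag ltnn.
- by have [_] := lact_ract_desc yx'; rewrite -e yx lact_diag ltnn.
- by have [_] := lact_ract_asc xy'; rewrite -e yx lact_diag ltnn.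
- by rewrite yx yx'.
Qed.

(** For x < y the inequality ract_lact_asc_le is an equality, since it holds all
    along the cycle of y under the permutation lact x. *)
Lemma ract_lact x y : ract x (lact x y) = ract x y.
Proof.
case: (ltngtP x y) => [xy|/ract_lact_desc//|/val_inj->]; last first.
  by rewrite lact_diag.
apply/val_inj/anti_leq; rewrite ract_lact_asc_le //=.
have := @ract_iter_antimono x y 1 N xy (ltnW exponent_gt1).
by rewrite iter_exponent_id //; apply: lact_inj.
Qed.

(** * The action of the monoid on letters *)

Lemma power_exchange x y :
  joinable (nseq N x ++ [:: y]) (y :: nseq N (ract x y)).
Proof.
have := joinable_power x y N; rewrite iter_exponent_id; last exact: lact_inj.
suff -> k : tails x y k = nseq k (ract x y) by [].
elim: k => //= k ->; congr (_ :: _).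
by elim: k => //= k; rewrite ract_lact.
Qed.

Lemma power_exchange2 x y z :
  joinable (nseq N x ++ [:: y; z]) ([:: y; z] ++ nseq N (ract (ract x y) z)).
Proof.
have := joinable_cat [::] [:: z] (power_exchange x y); rewrite -catA /=.
move=> /joinable_trans; apply.
have := joinable_cat [:: y] [::] (power_exchange (ract x y) z).
by rewrite !cats0.
Qed.

(** The letter x, then ract x y, then ract (ract x y) z is the repeated one,
    according to whether x^N stops in front of y, between y and z or behind z.
    The permutations ract^~ y and ract^~ z preserve the letters above y and
    above z, so in each case the word is sorted. *)
Definition power_normal_form x y z : seq X :=
  if x <= y then nseq N x ++ [:: y; z]
  else if ract x y <= z then y :: nseq N (ract x y) ++ [:: z]
  else [:: y; z] ++ nseq N (ract (ract x y) z).

Lemma power_normal_formP x y z :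
  joinable (nseq N x ++ [:: y; z]) (power_normal_form x y z).
Proof.
rewrite /power_normal_form; case: ifP => _; first exact: joinable_refl.
case: ifP => _; last exact: power_exchange2.
by have := joinable_cat [::] [:: z] (power_exchange x y); rewrite -catA.
Qed.

Lemma power_normal_form_increasing x y z :
  y < z -> increasing (power_normal_form x y z).
Proof.
have nseqP k (t : X) (w : seq X) :
    increasing (t :: w) -> increasing (nseq k t ++ w).
  move=> tw; elim: k => [|[|k] IH] //=; first exact: path_sorted tw.
  by rewrite /increasing /= leqnn.
have pathP k (t t' : X) (w : seq X) : t <= t' -> increasing (t' :: w) ->
    increasing (t :: nseq k.+1 t' ++ w).
  by move=> tt' /(nseqP k.+1); rewrite /increasing /= tt'.
move=> yz; have yz' := ltnW yz.
rewrite /power_normal_form; case: leqP => [xy|yx].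
  by apply: nseqP; rewrite /increasing /= xy yz'.
have -> : N = N.-1.+1 by rewrite prednK // ltnW // exponent_gt1.
case: leqP => [tz|zt].
  by apply: pathP; [apply/ltnW/ract_desc_gt | rewrite /increasing /= tz].
rewrite -[nseq _ _]cats0 /increasing /= yz'.
by apply: (pathP _ _ _ [::]); first exact/ltnW/ract_desc_gt.
Qed.

Lemma power_normal_form_inj y z : y < z ->
  injective (fun x => power_normal_form x y z).
Proof.
move=> yz x x'; rewrite /power_normal_form.
have -> : N = N.-2.+2 by have := exponent_gt1; case: N => [|[]].
have gt (t : X) : y < t -> y < ract t y by apply: ract_desc_gt.
have gt' (t : X) : z < t -> z < ract t z by apply: ract_desc_gt.
case: (leqP x y) => [xy|/gt yx]; case: (leqP x' y) => [xy'|/gt yx'] /=.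
- by case.
- by case: leqP => _ [_ ex]; move: xy; rewrite leqNgt ex ?yz ?yx'.
- by case: leqP => _ [_ ex]; move: xy'; rewrite leqNgt -ex ?yz ?yx.
- case: leqP => [tz|/gt' tz]; case: leqP => [tz'|/gt' tz'] [].
  + by move/ract_inj.
  + by move=> _ ex; move: tz; rewrite ex leqNgt tz'.
  + by move=> _ ex; move: tz'; rewrite -ex leqNgt tz.
  + by move/ract_inj/ract_inj.
Qed.

(** Moved through either side of y z = y' z', the power x^N becomes a power of
    one letter. If these letters differed, the power obtained through y' z'
    would also come through y z from another letter x', and x^N y z = x'^N y z
    would contradict the uniqueness of normal forms. *)
Lemma ract_action_asc x y z : y < z ->
  ract (ract x y) z = ract (ract x (lact y z)) (ract y z).
Proof.
move=> yz; set y' := lact y z; set z' := ract y z; set v := ract _ z'.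
have [t et] := ract_onto z v; have [x' ex'] := ract_onto y t.
have ev : ract (ract x' y) z = v by rewrite ex'.
suff <- : x' = x by [].
apply: (power_normal_form_inj yz).
apply: normal_form_unique; try exact: power_normal_form_increasing.
apply: joinable_trans (power_normal_formP x y z).
apply: joinable_trans (joinable_sym (power_normal_formP x' y z)) _.
have yz'y := joinable_swap y z.
apply: joinable_trans (power_exchange2 x' y z) _; rewrite ev.
apply: joinable_trans (joinable_cat [::] (nseq N v) yz'y) _.
apply: joinable_trans (joinable_sym (power_exchange2 x y' z')) _.
have := joinable_cat (nseq N x) [::] (joinable_sym yz'y).
by rewrite !cats0.
Qed.

Lemma ract_action x y z :
  ract (ract x y) z = ract (ract x (lact y z)) (ract y z).
Proof.
case: (ltngtP y z) => [/ract_action_asc->//|zy|/val_inj->]; last first.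
  by rewrite lact_diag ract_diag.
have [lt _] := lact_ract_desc zy; rewrite (ract_action_asc x lt).
by rewrite /lact /ract -rmap_pair rmapK.
Qed.

(** * The Yang-Baxter equation *)

(** Each letter is replaced by what becomes of it after it has been moved to the
    right end of the word. *)
Definition coordinates (t : X * X * X) : X * X * X :=
  let: (x, y, z) := t in (ract (ract x y) z, ract y z, z).

Lemma coordinates_inj : injective coordinates.
Proof.
move=> [[x y] z] [[x' y'] z'] [e1 e2 e3].
by move: e2 e1; rewrite -e3 => /ract_inj <- /ract_inj /ract_inj ->.
Qed.

Lemma coordinates_r_1 t :
  coordinates (r_1 r t) = (let: (a, b, c) := coordinates t in (b, a, c)).
Proof.
case: t => -[x y] z; rewrite /r_1 rmap_pair /coordinates /=.
by rewrite [ract (lact x y) _]/ract -rmap_pair rmapK.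
Qed.

Lemma coordinates_r_2 t :
  coordinates (r_2 r t) = (let: (a, b, c) := coordinates t in (a, c, b)).
Proof.
case: t => -[x y] z; rewrite /r_2 rmap_pair /coordinates /=.
by rewrite -ract_action [ract (lact y z) _]/ract -rmap_pair rmapK.
Qed.

Lemma rmap_yang_baxter : yang_baxter r.
Proof.
move=> t; apply: coordinates_inj => /=.
rewrite !(coordinates_r_1, coordinates_r_2).
by case: (coordinates t) => [[a b] c].
Qed.

Lemma rmap_right_nondegenerate (a b : X) : exists cd : X * X,
  unique (fun cd' : X * X => r (cd'.1, a) = (cd'.2, b)) cd /\
  (a = b -> cd.1 = cd.2).
Proof.
have [c ec] := ract_onto a b; exists (c, lact c a); split.
  split=> [|[c' d'] /= rc']; first by rewrite /= rmap_pair ec.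
  have cc' : c = c' by apply: (@ract_inj a); rewrite /= ec /ract rc'.
  by rewrite cc' /lact rc'.
move=> eab; have -> : c = a by apply: (@ract_inj a); rewrite /= ec ract_diag.
by rewrite /= lact_diag.
Qed.

End SkewRelations.

Theorem theorem1p2 (n : nat) (u : 'I_n -> 'I_n -> 'I_n * 'I_n)
    (u1 : star1 u) (u2 : star2 u) (u3 : star3 u) :
  rmap u \o rmap u =1 id /\
  yang_baxter (rmap u) /\
  (forall a b : 'I_n, exists cd : 'I_n * 'I_n,
     unique (fun cd' : 'I_n * 'I_n => rmap u (cd'.1, a) = (cd'.2, b)) cd /\
     (a = b -> cd.1 = cd.2)).
Proof.
split; first exact: rmapK.
split; first exact: rmap_yang_baxter.
exact: rmap_right_nondegenerate.
Qed.
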